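(* Let $\Gamma$ be a local type environment and $\mathcal{M}$ a multiparty session. If $\Gamma\vdash\mathcal{M}$ and $\Gamma\xrightarrow{(\mathtt{p},\mathtt{q})\ell}\Gamma'$, then there exist a message label $\ell'$, a local type environment $\Gamma''$ and a session $\mathcal{M}'$ such that $\mathcal{M}\xrightarrow{(\mathtt{p},\mathtt{q})\ell'}\mathcal{M}'$, $\Gamma\xrightarrow{(\mathtt{p},\mathtt{q})\ell'}\Gamma''$ and $\Gamma''\vdash\mathcal{M}'$.
   Context: PROCESSES. Processes: $P ::= \mathtt{p}!\ell(e).P \mid \sum_{i\in I}\mathtt{p}?\ell_i(x_i).P_i \mid \mathtt{if}\ e\ \mathtt{then}\ P\ \mathtt{else}\ P \mid \mu X.P \mid X \mid \mathbf{0}$, with $I$ finite nonempty, recursion guarded; expressions $e$ are variables, values (booleans, integers, naturals) or built with operators such as $\mathtt{succ}$, $\mathtt{neg}$, $\neg$ and nondeterministic choice; $e\downarrow v$ is standard evaluation. Sessions: $\mathcal{M} ::= \mathtt{p}\triangleleft P \mid \mathcal{M}\mid\mathcal{M} \mid \mathcal{O}$; $\prod_{i\in I}\mathtt{p}_i\triangleleft P_i$ is parallel composition. Structural congruence $\equiv$ is the least congruence with $\mathcal{M}\mid\mathcal{N}\equiv\mathcal{N}\mid\mathcal{M}$, $(\mathcal{L}\mid\mathcal{M})\mid\mathcal{N}\equiv\mathcal{L}\mid(\mathcal{M}\mid\mathcal{N})$, $\mathcal{M}\mid\mathcal{O}\equiv\mathcal{M}$. Unfolding $\Rrightarrow$ is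 the least relation with: $\mathcal{M}\equiv\mathcal{N}\Rightarrow\mathcal{M}\Rrightarrow\mathcal{N}$; transitivity; $\mathtt{p}\triangleleft\mu X.P\mid\mathcal{N}\Rrightarrow\mathtt{p}\triangleleft P[\mu X.P/X]\mid\mathcal{N}$; $e\downarrow\mathtt{true}\Rightarrow \mathtt{p}\triangleleft\mathtt{if}\ e\ \mathtt{then}\ P\ \mathtt{else}\ Q\mid\mathcal{N}\Rrightarrow\mathtt{p}\triangleleft P\mid\mathcal{N}$; $e\downarrow\mathtt{false}\Rightarrow \mathtt{p}\triangleleft\mathtt{if}\ e\ \mathtt{then}\ P\ \mathtt{else}\ Q\mid\mathcal{N}\Rrightarrow\mathtt{p}\triangleleft Q\mid\mathcal{N}$. Labelled reduction is the least relation with: (R-comm) if $j\in I$ and $e\downarrow v$ then $\mathtt{q}\triangleleft\sum_{i\in I}\mathtt{p}?\ell_i(x_i).P_i\mid\mathtt{p}\triangleleft\mathtt{q}!\ell_j(e).Q\mid\mathcal{N}\xrightarrow{(\mathtt{p},\mathtt{q})\ell_j}\mathtt{q}\triangleleft P_j[v/x_j]\mid\mathtt{p}\triangleleft Q\mid\mathcal{N}$ (the first participant of the label is the sender); (R-unfold) if $\mathcal{M}\Rrightarrow\mathcal{M}'$, $\mathcal{M}'\xrightarrow{\lambda}\mathcal{N}'$ and $\mathcal{N}'\Rrightarrow\mathcal{N}$ then $\mathcal{M}\xrightarrow{\lambda}\mathcal{N}$. TYPES. Sorts $\mathtt{int},\mathtt{bool},\mathtt{nat}$, subsorting $\le$ least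 reflexive with $\mathtt{nat}\le\mathtt{int}$. Local types coinductively: $T ::= \mathtt{end}\mid\mathtt{p}\&\{\ell_i(S_i).T_i\}_{i\in I}\mid\mathtt{p}\oplus\{\ell_i(S_i).T_i\}_{i\in I}$. Subtyping $\le$: largest relation with $\mathtt{end}\le\mathtt{end}$; $\mathtt{p}\&\{\ell_i(S_i).T_i\}_{i\in I\cup J}\le\mathtt{p}\&\{\ell_i(S'_i).T'_i\}_{i\in I}$ if $S'_i\le S_i$, $T_i\le T'_i$ for $i\in I$; $\mathtt{p}\oplus\{\ell_i(S_i).T_i\}_{i\in I}\le\mathtt{p}\oplus\{\ell_i(S'_i).T'_i\}_{i\in I\cup J}$ if $S_i\le S'_i$, $T_i\le T'_i$ for $i\in I$. Global types coinductively: $\mathbb{G}::=\mathtt{end}\mid\mathtt{p}\to\mathtt{q}:\{\ell_i(S_i).\mathbb{G}_i\}_{i\in I}$; $\mathrm{pt}(\mathbb{G})$ least solution of $\mathrm{pt}(\mathtt{end})=\emptyset$, $\mathrm{pt}(\mathtt{p}\to\mathtt{q}:\{\ell_i(S_i).\mathbb{G}_i\})=\{\mathtt{p},\mathtt{q}\}\cup\bigcup_i\mathrm{pt}(\mathbb{G}_i)$. Projection $\mathbb{G}\upharpoonright\mathtt{r}$ is the (functional) largest relation such that: $\mathtt{r}\notin\mathrm{pt}(\mathbb{G})$ gives $\mathtt{end}$; $\mathtt{p}\to\mathtt{r}:\{\ell_i(S_i).\mathbb{G}_i\}$ gives $\mathtt{p}\&\{\ell_i(S_i).T_i\}$ with $\mathbb{G}_i\upharpoonright\mathtt{r}=T_i$;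 $\mathtt{r}\to\mathtt{q}:\{\ell_i(S_i).\mathbb{G}_i\}$ gives $\mathtt{q}\oplus\{\ell_i(S_i).T_i\}$ with $\mathbb{G}_i\upharpoonright\mathtt{r}=T_i$; $\mathtt{p}\to\mathtt{q}:\{\ell_i(S_i).\mathbb{G}_i\}$ with $\mathtt{r}\notin\{\mathtt{p},\mathtt{q}\}$ gives $T$ with $\mathbb{G}_i\upharpoonright\mathtt{r}=T$ for all $i$. $\mathbb{G}$ is balanced if for every subtree $\mathbb{G}'$ there is $k$ such that every $\mathtt{p}\in\mathrm{pt}(\mathbb{G}')$ occurs on every path from the root of $\mathbb{G}'$ of length $\ge k$ or ending in $\mathtt{end}$. A local type environment $\Gamma$ is a finite map from participants to local types; $\Gamma_1,\Gamma_2$ is disjoint union. $\Gamma\sqsubseteq\mathbb{G}$ (association) iff for all $\mathtt{p}\in\mathrm{pt}(\mathbb{G})$, $\mathtt{p}\in\mathrm{dom}(\Gamma)$ and $\Gamma(\mathtt{p})\le\mathbb{G}\upharpoonright\mathtt{p}$, and for all $\mathtt{p}\notin\mathrm{pt}(\mathbb{G})$, $\mathtt{p}\notin\mathrm{dom}(\Gamma)$ or $\Gamma(\mathtt{p})=\mathtt{end}$. Environment transitions are the least relation with: $\mathtt{p}:\mathtt{q}\&\{\ell_i(S_i).T_i\}_{i\in I}\xrightarrow{\mathtt{p}:\mathtt{q}\&\ell_k(S_k)}\mathtt{p}:T_k$ and $\mathtt{p}:\mathtt{q}\oplus\{\ell_i(S_i).T_i\}_{i\in I}\xrightarrow{\mathtt{p}:\mathtt{q}\oplus\ell_k(S_k)}\mathtt{p}:T_k$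 ($k\in I$); $\Gamma\xrightarrow{\alpha}\Gamma'\Rightarrow\Gamma,\mathtt{p}:T\xrightarrow{\alpha}\Gamma',\mathtt{p}:T$; $\Gamma_1\xrightarrow{\mathtt{p}:\mathtt{q}\oplus\ell(S)}\Gamma_1'$, $\Gamma_2\xrightarrow{\mathtt{q}:\mathtt{p}\&\ell(S')}\Gamma_2'$, $S\le S'$ $\Rightarrow$ $\Gamma_1,\Gamma_2\xrightarrow{(\mathtt{p},\mathtt{q})\ell}\Gamma_1',\Gamma_2'$. TYPING. $\Theta\vdash P:T$ is the least relation with (expression typing $\Theta\vdash e:S$ standard): $\Theta\vdash\mathbf{0}:\mathtt{end}$; $\Theta,X:T\vdash X:T$; $\Theta,X:T\vdash P:T\Rightarrow\Theta\vdash\mu X.P:T$; $\Theta\vdash e:\mathtt{bool}$, $\Theta\vdash P_1:T$, $\Theta\vdash P_2:T\Rightarrow\Theta\vdash\mathtt{if}\ e\ \mathtt{then}\ P_1\ \mathtt{else}\ P_2:T$; $\Theta\vdash P:T$, $T\le T'\Rightarrow\Theta\vdash P:T'$; $\forall i\in I.\ \Theta,x_i:S_i\vdash P_i:T_i\Rightarrow\Theta\vdash\sum_{i\in I}\mathtt{p}?\ell_i(x_i).P_i:\mathtt{p}\&\{\ell_i(S_i).T_i\}_{i\in I}$; $\Theta\vdash e:S$, $\Theta\vdash P:T\Rightarrow\Theta\vdash\mathtt{p}!\ell(e).P:\mathtt{p}\oplus\{\ell(S).T\}$. Session typing: $\Gamma\vdash\prod_{i\in I}\mathtt{p}_i\triangleleft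 P_i$ iff for all $i\in I$, $\emptyset\vdash P_i:\Gamma(\mathtt{p}_i)$, and $\Gamma\sqsubseteq\mathbb{G}$ for some balanced, well-formed global type $\mathbb{G}$ projectable onto every participant.
   Formalization: Session typing additionally requires that the participants of the session be pairwise distinct and that every participant of the global type occur in the session (also proved for M'); without this the claim fails, e.g. for the empty session. *)

(* Defs.v *)
From HB Require Import structures.
From mathcomp Require Import all_boot all_order all_algebra.
From mathcomp Require Import finmap.

Set Implicit Arguments.
Unset Strict Implicit.
Unset Printing Implicit Defensive.

Definition participant := nat.
Definition label := nat.

(* A family {l_i . a_i}_(i in I) with I finite nonempty and the labels l_i
   pairwise distinct, i.e. a nonempty finite map from labels, written as a
   nonempty association list.  It is only ever read through [labels] (the index
   set I) and [lookup]; when a label is repeated the first entry is the value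
   of the map. *)
Inductive branches (A : Type) : Type :=
| BOne of label & A
| BCons of label & A & branches A.

Section Branches.
Variables A B : Type.

Fixpoint lookup (l : label) (bs : branches A) : option A :=
  match bs with
  | BOne l0 a => if l == l0 then Some a else None
  | BCons l0 a bs0 => if l == l0 then Some a else lookup l bs0
  end.

Fixpoint labels (bs : branches A) : seq label :=
  match bs with
  | BOne l0 _ => [:: l0]
  | BCons l0 _ bs0 => l0 :: labels bs0
  end.

Variables (f : A -> B) (b : pred A).

Fixpoint bmap (bs : branches A) : branches B :=
  match bs with
  | BOne l0 a => BOne l0 (f a)
  | BCons l0 a bs0 => BCons l0 (f a) (bmap bs0)
  end.

Fixpoint ball (bs : branches A) : bool :=
  match bs with
  | BOne _ a => b a
  | BCons _ a bs0 => b a && ball bs0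
  end.
End Branches.

(** * Expressions *)

Inductive value : Type :=
| VBool of bool
| VInt of int
| VNat of nat.

(* De Bruijn indices for expression variables. *)
Inductive expr : Type :=
| EVar of nat
| EVal of value
| ESucc of expr
| ENeg of expr
| ENot of expr
| EChoice of expr & expr.

Inductive eval : expr -> value -> Prop :=
| ev_val v : eval (EVal v) v
| ev_succ e n : eval e (VNat n) -> eval (ESucc e) (VNat n.+1)
| ev_neg_int e z : eval e (VInt z) -> eval (ENeg e) (VInt (- z)%R)
| ev_neg_nat e n : eval e (VNat n) -> eval (ENeg e) (VInt (- n%:Z)%R)
| ev_not e b : eval e (VBool b) -> eval (ENot e) (VBool (~~ b))
| ev_choice_l e1 e2 v : eval e1 v -> eval (EChoice e1 e2) v
| ev_choice_r e1 e2 v : eval e2 v -> eval (EChoice e1 e2) v.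

Fixpoint elift (k : nat) (e : expr) : expr :=
  match e with
  | EVar n => EVar (if n < k then n else n.+1)
  | EVal v => EVal v
  | ESucc e1 => ESucc (elift k e1)
  | ENeg e1 => ENeg (elift k e1)
  | ENot e1 => ENot (elift k e1)
  | EChoice e1 e2 => EChoice (elift k e1) (elift k e2)
  end.

Fixpoint esubst (k : nat) (v : value) (e : expr) : expr :=
  match e with
  | EVar n => if n == k then EVal v else EVar (if n < k then n else n.-1)
  | EVal w => EVal w
  | ESucc e1 => ESucc (esubst k v e1)
  | ENeg e1 => ENeg (esubst k v e1)
  | ENot e1 => ENot (esubst k v e1)
  | EChoice e1 e2 => EChoice (esubst k v e1) (esubst k v e2)
  end.

(** * Processes *)

(* Expression variables and process variables are two separate families of
   De Bruijn indices: each branch of [PRecv] binds one expression variable, and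
   [PRec] binds one process variable. *)
Inductive process : Type :=
| PSend of participant & label & expr & process
| PRecv of participant & branches process
| PIf of expr & process & process
| PRec of process
| PVar of nat
| PEnd.

Fixpoint lift_e (k : nat) (P : process) : process :=
  match P with
  | PSend p l e P1 => PSend p l (elift k e) (lift_e k P1)
  | PRecv p bs => PRecv p (bmap (lift_e k.+1) bs)
  | PIf e P1 P2 => PIf (elift k e) (lift_e k P1) (lift_e k P2)
  | PRec P1 => PRec (lift_e k P1)
  | PVar X => PVar X
  | PEnd => PEnd
  end.

Fixpoint lift_p (k : nat) (P : process) : process :=
  match P with
  | PSend p l e P1 => PSend p l e (lift_p k P1)
  | PRecv p bs => PRecv p (bmap (lift_p k) bs)
  | PIf e P1 P2 => PIf e (lift_p k P1) (lift_p k P2)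
  | PRec P1 => PRec (lift_p k.+1 P1)
  | PVar X => PVar (if X < k then X else X.+1)
  | PEnd => PEnd
  end.

(* P[v/x] for the expression variable x of index k *)
Fixpoint vsubst (k : nat) (v : value) (P : process) : process :=
  match P with
  | PSend p l e P1 => PSend p l (esubst k v e) (vsubst k v P1)
  | PRecv p bs => PRecv p (bmap (vsubst k.+1 v) bs)
  | PIf e P1 P2 => PIf (esubst k v e) (vsubst k v P1) (vsubst k v P2)
  | PRec P1 => PRec (vsubst k v P1)
  | PVar X => PVar X
  | PEnd => PEnd
  end.

(* P[Q/X] for the process variable X of index k *)
Fixpoint psubst (k : nat) (Q P : process) : process :=
  match P with
  | PSend p l e P1 => PSend p l e (psubst k Q P1)
  | PRecv p bs => PRecv p (bmap (psubst k (lift_e 0 Q)) bs)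
  | PIf e P1 P2 => PIf e (psubst k Q P1) (psubst k Q P2)
  | PRec P1 => PRec (psubst k.+1 (lift_p 0 Q) P1)
  | PVar X => if X == k then Q else PVar (if X < k then X else X.-1)
  | PEnd => PEnd
  end.

(* X occurs in P outside of any communication prefix *)
Fixpoint unguarded_occ (X : nat) (P : process) : bool :=
  match P with
  | PIf _ P1 P2 => unguarded_occ X P1 || unguarded_occ X P2
  | PRec P1 => unguarded_occ X.+1 P1
  | PVar Y => Y == X
  | _ => false
  end.

Fixpoint guarded (P : process) : bool :=
  match P with
  | PSend _ _ _ P1 => guarded P1
  | PRecv _ bs => ball guarded bs
  | PIf _ P1 P2 => guarded P1 && guarded P2
  | PRec P1 => ~~ unguarded_occ 0 P1 && guarded P1
  | PVar _ => true
  | PEnd => true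
  end.

(** * Sessions *)

Inductive session : Type :=
| SPart of participant & process
| SPar of session & session
| SNil.

Fixpoint components (M : session) : seq (participant * process) :=
  match M with
  | SPart p P => [:: (p, P)]
  | SPar M1 M2 => components M1 ++ components M2
  | SNil => [::]
  end.

Definition participants (M : session) : seq participant :=
  [seq c.1 | c <- components M].

(* The grammar of processes only contains guarded recursion. *)
Definition guarded_session (M : session) : bool :=
  all (fun c => guarded c.2) (components M).

Inductive scong : session -> session -> Prop :=
| sc_refl M : scong M M
| sc_sym M N : scong M N -> scong N M
| sc_trans L M N : scong L M -> scong M N -> scong L N
| sc_par M M' N N' : scong M M' -> scong N N' -> scong (SPar M N) (SPar M' N')
| sc_comm M N : scong (SPar M N) (SPar N M)
| sc_assoc L M N : scong (SPar (SPar L M) N) (SPar L (SPar M N))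
| sc_nil M : scong (SPar M SNil) M.

Inductive unfolds : session -> session -> Prop :=
| un_struct M N : scong M N -> unfolds M N
| un_trans L M N : unfolds L M -> unfolds M N -> unfolds L N
| un_rec p P N :
    unfolds (SPar (SPart p (PRec P)) N)
            (SPar (SPart p (psubst 0 (PRec P) P)) N)
| un_true p e P Q N :
    eval e (VBool true) ->
    unfolds (SPar (SPart p (PIf e P Q)) N) (SPar (SPart p P) N)
| un_false p e P Q N :
    eval e (VBool false) ->
    unfolds (SPar (SPart p (PIf e P Q)) N) (SPar (SPart p Q) N).

(* [sred M p q l N]: M reduces to N with label (p,q)l, where p is the sender. *)
Inductive sred : session -> participant -> participant -> label -> session ->
    Prop :=
| R_comm p q l e v bs P Q N :
    lookup l bs = Some P -> eval e v ->
    sred (SPar (SPar (SPart q (PRecv p bs)) (SPart p (PSend q l e Q))) N)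
         p q l
         (SPar (SPar (SPart q (vsubst 0 v P)) (SPart p Q)) N)
| R_unfold M M' N' N p q l :
    unfolds M M' -> sred M' p q l N' -> unfolds N' N -> sred M p q l N.

(** * Local types *)

Inductive sort : Type := SInt | SBool | SNat.

Inductive subsort : sort -> sort -> Prop :=
| ss_refl S : subsort S S
| ss_nat_int : subsort SNat SInt.

CoInductive ltype : Type :=
| LEnd
| LRecv of participant & branches (sort * ltype)
| LSend of participant & branches (sort * ltype).

CoInductive subtype : ltype -> ltype -> Prop :=
| sub_end : subtype LEnd LEnd
| sub_recv p bs bs' :
    {subset labels bs' <= labels bs} ->
    (forall l S T S' T', lookup l bs = Some (S, T) ->
       lookup l bs' = Some (S', T') -> subsort S' S) ->
    (forall l S T S' T', lookup l bs = Some (S, T) ->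
       lookup l bs' = Some (S', T') -> subtype T T') ->
    subtype (LRecv p bs) (LRecv p bs')
| sub_send p bs bs' :
    {subset labels bs <= labels bs'} ->
    (forall l S T S' T', lookup l bs = Some (S, T) ->
       lookup l bs' = Some (S', T') -> subsort S S') ->
    (forall l S T S' T', lookup l bs = Some (S, T) ->
       lookup l bs' = Some (S', T') -> subtype T T') ->
    subtype (LSend p bs) (LSend p bs').

(** * Global types *)

CoInductive gtype : Type :=
| GEnd
| GComm of participant & participant & branches (sort * gtype).

(* [in_pt r G]: r belongs to pt(G) *)
Inductive in_pt (r : participant) : gtype -> Prop :=
| pt_sender q bs : in_pt r (GComm r q bs)
| pt_receiver p bs : in_pt r (GComm p r bs)
| pt_cont p q bs l S G :
    lookup l bs = Some (S, G) -> in_pt r G -> in_pt r (GComm p q bs).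

(* The membership premise of [proj_skip] makes the largest relation functional:
   without it, a tree in which r never occurs and which has an infinite path
   would project to every local type. *)
CoInductive proj (r : participant) : gtype -> ltype -> Prop :=
| proj_end G : ~ in_pt r G -> proj r G LEnd
| proj_recv p bs ts :
    labels bs =i labels ts ->
    (forall l S G S' T, lookup l bs = Some (S, G) ->
       lookup l ts = Some (S', T) -> S = S') ->
    (forall l S G S' T, lookup l bs = Some (S, G) ->
       lookup l ts = Some (S', T) -> proj r G T) ->
    proj r (GComm p r bs) (LRecv p ts)
| proj_send q bs ts :
    labels bs =i labels ts ->
    (forall l S G S' T, lookup l bs = Some (S, G) ->
       lookup l ts = Some (S', T) -> S = S') ->
    (forall l S G S' T, lookup l bs = Some (S, G) ->
       lookup l ts = Some (S', T) -> proj r G T) ->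
    proj r (GComm r q bs) (LSend q ts)
| proj_skip p q bs T :
    r <> p -> r <> q -> in_pt r (GComm p q bs) ->
    (forall l S G, lookup l bs = Some (S, G) -> proj r G T) ->
    proj r (GComm p q bs) T.

(* [gpath G w G']: w lists the communications met along a path of the tree
   starting at the root of G and ending at the root of G'. *)
Inductive gpath : gtype -> seq (participant * participant) -> gtype -> Prop :=
| gp_nil G : gpath G [::] G
| gp_cons p q bs l S G w G' :
    lookup l bs = Some (S, G) -> gpath G w G' ->
    gpath (GComm p q bs) ((p, q) :: w) G'.

Definition subtree (G' G : gtype) : Prop := exists w, gpath G w G'.

Definition occurs_on (r : participant) (w : seq (participant * participant)) :
    bool :=
  has (fun c => (r == c.1) || (r == c.2)) w.

Definition balanced (G : gtype) : Prop :=
  forall G', subtree G' G ->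
  exists k : nat, forall r, in_pt r G' ->
    forall w G'', gpath G' w G'' -> (k <= size w \/ G'' = GEnd) ->
    occurs_on r w.

(* Nonemptiness of the index sets and distinctness of labels are built into
   [branches]; what remains is that nobody communicates with itself. *)
Definition gwf (G : gtype) : Prop :=
  forall p q bs, subtree (GComm p q bs) G -> p <> q.

Definition projectable (G : gtype) : Prop :=
  forall r, exists T, proj r G T.

(** * Local type environments *)

Definition env : Type := {fmap participant -> ltype}.

Definition assoc (Gamma : env) (G : gtype) : Prop :=
  (forall p, in_pt p G ->
     exists T U, [/\ Gamma.[? p]%fmap = Some T, proj p G U & subtype T U]) /\
  (forall p, ~ in_pt p G ->
     Gamma.[? p]%fmap = None \/ Gamma.[? p]%fmap = Some LEnd).

Inductive action : Type :=
| ARecv of participant & participant & label & sort   (* p : q & l(S) *)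
| ASend of participant & participant & label & sort   (* p : q (+) l(S) *)
| AComm of participant & participant & label.         (* (p,q)l *)

Inductive env_step : env -> action -> env -> Prop :=
| E_recv p q bs l S T :
    lookup l bs = Some (S, T) ->
    env_step [fmap].[p <- LRecv q bs]%fmap (ARecv p q l S) [fmap].[p <- T]%fmap
| E_send p q bs l S T :
    lookup l bs = Some (S, T) ->
    env_step [fmap].[p <- LSend q bs]%fmap (ASend p q l S) [fmap].[p <- T]%fmap
| E_frame Gamma Gamma' a p T :
    env_step Gamma a Gamma' -> p \notin domf Gamma -> p \notin domf Gamma' ->
    env_step Gamma.[p <- T]%fmap a Gamma'.[p <- T]%fmap
| E_comm Gamma1 Gamma1' Gamma2 Gamma2' p q l S S' :
    env_step Gamma1 (ASend p q l S) Gamma1' ->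
    env_step Gamma2 (ARecv q p l S') Gamma2' ->
    subsort S S' ->
    [disjoint domf Gamma1 & domf Gamma2]%fset ->
    [disjoint domf Gamma1' & domf Gamma2']%fset ->
    env_step (Gamma1 + Gamma2)%fset (AComm p q l) (Gamma1' + Gamma2')%fset.

(** * Typing *)

Inductive typ_expr (Es : seq sort) : expr -> sort -> Prop :=
| te_var x S : onth Es x = Some S -> typ_expr Es (EVar x) S
| te_bool b : typ_expr Es (EVal (VBool b)) SBool
| te_int z : typ_expr Es (EVal (VInt z)) SInt
| te_nat n : typ_expr Es (EVal (VNat n)) SNat
| te_succ e : typ_expr Es e SNat -> typ_expr Es (ESucc e) SNat
| te_neg e : typ_expr Es e SInt -> typ_expr Es (ENeg e) SInt
| te_not e : typ_expr Es e SBool -> typ_expr Es (ENot e) SBool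
| te_choice e1 e2 S :
    typ_expr Es e1 S -> typ_expr Es e2 S -> typ_expr Es (EChoice e1 e2) S
| te_sub e S S' : typ_expr Es e S -> subsort S S' -> typ_expr Es e S'.

(* The context Theta is the pair of Es (sorts of the expression variables) and
   Ps (types of the process variables). *)
Inductive typ_proc : seq sort -> seq ltype -> process -> ltype -> Prop :=
| tp_end Es Ps : typ_proc Es Ps PEnd LEnd
| tp_var Es Ps X T : onth Ps X = Some T -> typ_proc Es Ps (PVar X) T
| tp_rec Es Ps P T : typ_proc Es (T :: Ps) P T -> typ_proc Es Ps (PRec P) T
| tp_if Es Ps e P1 P2 T :
    typ_expr Es e SBool -> typ_proc Es Ps P1 T -> typ_proc Es Ps P2 T ->
    typ_proc Es Ps (PIf e P1 P2) T
| tp_sub Es Ps P T T' :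
    typ_proc Es Ps P T -> subtype T T' -> typ_proc Es Ps P T'
| tp_recv Es Ps p bs ts :
    labels bs =i labels ts ->
    (forall l P S T, lookup l bs = Some P -> lookup l ts = Some (S, T) ->
       typ_proc (S :: Es) Ps P T) ->
    typ_proc Es Ps (PRecv p bs) (LRecv p ts)
| tp_send Es Ps p l e P S T :
    typ_expr Es e S -> typ_proc Es Ps P T ->
    typ_proc Es Ps (PSend p l e P) (LSend p (BOne l (S, T))).

(* In the product of the p_i <| P_i the p_i are pairwise distinct, and the
   product covers the participants of G (a session missing one of them could
   not follow the transitions of Gamma). *)
Definition typ_sess (Gamma : env) (M : session) : Prop :=
  [/\ uniq (participants M),
      forall i p P, onth (components M) i = Some (p, P) ->
        exists2 T, Gamma.[? p]%fmap = Some T & typ_proc [::] [::] P T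
    & exists G,
        [/\ balanced G, gwf G, projectable G, assoc Gamma G
          & forall p, in_pt p G -> p \in participants M]].

(* Main.v *)
Require Import Defs.
From mathcomp Require Import all_boot all_order all_algebra.
From mathcomp Require Import finmap zify.

Set Implicit Arguments.
Unset Strict Implicit.
Unset Printing Implicit Defensive.

(** The transition of Gamma makes p a sender to q and q a receiver from p, and
    association forces both to take part in G.  Typed guarded processes unfold
    to a communication prefix, so p runs some q!l'(e).P and q an input from p.
    The projections of G on p and q are read off the same nodes p -> q, hence
    carry the same labels and sorts; subtyping then makes l' a label offered by
    q, and the session and Gamma both step with l'.  The reduced environment is
    associated with the global type obtained from G by replacing every topmost
    node p -> q by its l'-continuation.  By balance those nodes lie at bounded
    depth, so this type is defined, and each of its properties proved, by
    recursion on that depth; no coinduction is needed. *)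

(** * Branches *)

Section BranchesTheory.
Variables A B : Type.
Implicit Types bs : branches A.

Lemma lookup_labels l bs : (l \in labels bs) = lookup l bs :> bool.
Proof.
by elim: bs => [l0 a | l0 a bs IH] /=; rewrite inE; case: eqP.
Qed.

Lemma labels_lookup l bs : l \in labels bs -> exists a, lookup l bs = Some a.
Proof. by rewrite lookup_labels; case: lookup => // a _; exists a. Qed.

Lemma lookup_in_labels l bs a : lookup l bs = Some a -> l \in labels bs.
Proof. by rewrite lookup_labels => ->. Qed.

Lemma lookup_nonempty bs : exists l a, lookup l bs = Some a.
Proof. by case: bs => l a; exists l, a; rewrite /= eqxx. Qed.

Lemma labels_bmap (f : A -> B) bs : labels (bmap f bs) = labels bs.
Proof. by elim: bs => //= l a bs ->. Qed.

Lemma lookup_bmap (f : A -> B) l bs :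
  lookup l (bmap f bs) = omap f (lookup l bs).
Proof. by elim: bs => [l0 a | l0 a bs IH] /=; case: eqP. Qed.

Lemma lookup_bmap_Some (f : A -> B) l bs b :
  lookup l (bmap f bs) = Some b -> exists2 a, lookup l bs = Some a & b = f a.
Proof. by rewrite lookup_bmap; case: lookup => //= a [<-]; exists a. Qed.

Lemma ball_bmap (f : A -> B) (b : pred B) bs :
  ball b (bmap f bs) = ball (fun a => b (f a)) bs.
Proof. by elim: bs => //= l a bs ->. Qed.

Lemma ball_lookup (b : pred A) bs l a :
  ball b bs -> lookup l bs = Some a -> b a.
Proof.
elim: bs => [l0 a0 | l0 a0 bs IH] /=; first by move=> ? ; case: eqP => // _ [<-].
by case/andP=> b0 bbs; case: eqP => [_ [<-] | _]; last exact: IH.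
Qed.

(** Finitely many branches, so the maximum of their bounds serves for all, by monotonicity. *)
Lemma lookup_uniform_bound (P : nat -> A -> Prop) bs :
  (forall k k' a, k <= k' -> P k a -> P k' a) ->
  (forall l a, lookup l bs = Some a -> exists k, P k a) ->
  exists k, forall l a, lookup l bs = Some a -> P k a.
Proof.
move=> monoP exP.
(* The induction runs over the labels with [bs] fixed: an entry shadowed by an earlier one with the
   same label has no bound to offer. *)
suff [k Pk] : exists k, forall l a, l \in labels bs ->
    lookup l bs = Some a -> P k a.
  by exists k => l a la; apply: (Pk l) => //; apply: lookup_in_labels la.
elim: (labels bs) => [|l0 ls [k Pk]]; first by exists 0.
have [k0 Pk0] : exists k0, forall a, lookup l0 bs = Some a -> P k0 a.
  case l0a: (lookup l0 bs) => [a|]; last by exists 0.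
  by have [k0 Pa] := exP _ _ l0a; exists k0 => _ [<-].
exists (maxn k k0) => l a; rewrite inE => /orP[/eqP-> | lls] la.
  by apply: monoP (Pk0 _ la); apply: leq_maxr.
by apply: monoP (Pk _ _ lls la); apply: leq_maxl.
Qed.

(** Shadowed entries count as well, because [ball], and hence [guarded], inspects them. *)
Fixpoint bForall (P : A -> Prop) bs : Prop :=
  match bs with
  | BOne _ a => P a
  | BCons _ a bs0 => P a /\ bForall P bs0
  end.

Lemma eq_ball (b1 b2 : pred A) bs :
  bForall (fun a => b1 a = b2 a) bs -> ball b1 bs = ball b2 bs.
Proof. by elim: bs => //= l a bs IH [-> /IH->]. Qed.

End BranchesTheory.

(* The automatic principle has no induction hypothesis for [PRecv]. *)
Lemma process_nested_ind (P : process -> Prop) :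
  (forall p l e Q, P Q -> P (PSend p l e Q)) ->
  (forall p bs, bForall P bs -> P (PRecv p bs)) ->
  (forall e Q1 Q2, P Q1 -> P Q2 -> P (PIf e Q1 Q2)) ->
  (forall Q, P Q -> P (PRec Q)) ->
  (forall X, P (PVar X)) -> P PEnd -> forall Q, P Q.
Proof.
move=> Psend Precv Pif Prec Pvar Pend; fix IH 1; case.
- by move=> p l e Q; apply: Psend.
- move=> p bs; apply: Precv; move: bs; fix IHbs 1; case=> [l Q | l Q bs] /=.
    exact: IH.
  by split; [exact: IH | exact: IHbs].
- by move=> e Q1 Q2; apply: Pif.
- by move=> Q; apply: Prec.
- exact: Pvar.
- exact: Pend.
Qed.

(** * Guardedness *)

Lemma unguarded_occ_lift_e k j P :
  unguarded_occ j (lift_e k P) = unguarded_occ j P.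
Proof. by elim: P j => //= e P IH1 Q IH2 j; rewrite IH1 IH2. Qed.

Lemma guarded_lift_e k P : guarded (lift_e k P) = guarded P.
Proof.
elim/process_nested_ind: P k => //= [p bs IH | e P Q IH1 IH2 | P IH] k.
- rewrite ball_bmap; apply: eq_ball.
  by elim: bs IH => [l P | l P bs IHbs] /=; [| case=> ? ?; split => //; exact: IHbs].
- by rewrite IH1 IH2.
- by rewrite unguarded_occ_lift_e IH.
Qed.

Lemma unguarded_occ_vsubst k v j P :
  unguarded_occ j (vsubst k v P) = unguarded_occ j P.
Proof. by elim: P j => //= e P IH1 Q IH2 j; rewrite IH1 IH2. Qed.

Lemma guarded_vsubst k v P : guarded (vsubst k v P) = guarded P.
Proof.
elim/process_nested_ind: P k => //= [p bs IH | e P Q IH1 IH2 | P IH] k.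
- rewrite ball_bmap; apply: eq_ball.
  by elim: bs IH => [l P | l P bs IHbs] /=; [| case=> ? ?; split => //; exact: IHbs].
- by rewrite IH1 IH2.
- by rewrite unguarded_occ_vsubst IH.
Qed.

(** Lifting at [k] frees the index [k], and an index above [k] comes from its predecessor. At
    [j = k = 0] the right-hand side is false. *)
Lemma unguarded_occ_lift_p k j P :
  unguarded_occ j (lift_p k P) =
  if j < k then unguarded_occ j P else (j != k) && unguarded_occ j.-1 P.
Proof.
elim: P k j => [p l e P _|p bs|e P IH1 Q IH2|P IH|X|] k j /=;
  rewrite ?andbF ?if_same //.
- by rewrite IH1 IH2; case: ifP => // _; case: (j != k).
- by rewrite IH ltnS eqSS; case: j => [|j] //=; case: k.
- by case: ltnP => Xk; case: ltnP => jk; lia.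
Qed.

Lemma guarded_lift_p k P : guarded (lift_p k P) = guarded P.
Proof.
elim/process_nested_ind: P k => //= [p bs IH | e P Q IH1 IH2 | P IH] k.
- rewrite ball_bmap; apply: eq_ball.
  by elim: bs IH => [l P | l P bs IHbs] /=; [| case=> ? ?; split => //; exact: IHbs].
- by rewrite IH1 IH2.
- by rewrite unguarded_occ_lift_p IH.
Qed.

(** Removing the index [k] does not renumber [j] below it, so an occurrence of [j] is either an old
    one or imported with [Q]. *)
Lemma unguarded_occ_psubst k j Q P : j < k ->
  unguarded_occ j (psubst k Q P) -> unguarded_occ j P || unguarded_occ j Q.
Proof.
elim: P k j Q => [p l e P _|p bs|e P IH1 P' IH2|P IH|X|] k j Q //= jk.
- case/orP=> [/(IH1 _ _ _ jk) | /(IH2 _ _ _ jk)] /orP[] ->; by rewrite ?orbT.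
- by move/IH; rewrite ltnS unguarded_occ_lift_p; apply.
- case: eqP => [_ -> | /eqP Xk /=]; first by rewrite orbT.
  by case: ltnP => [_ -> // | kX]; lia.
Qed.

Lemma guarded_psubst k Q P : guarded Q -> guarded P -> guarded (psubst k Q P).
Proof.
elim/process_nested_ind: P k Q =>
    //= [p bs IH | e P P' IH1 IH2 | P IH | X] k Q gQ.
- have {gQ}: guarded (lift_e 0 Q) by rewrite guarded_lift_e.
  move: (lift_e 0 Q) => {}Q gQ; rewrite ball_bmap.
  elim: bs IH => [l P | l P bs IHbs] /= => [IH | [IH1 IH2]]; first exact: IH.
  by case/andP=> /(IH1 k Q gQ)-> gbs; exact: IHbs.
- by case/andP=> /(IH1 k Q gQ)-> /(IH2 k Q gQ)->.
(* The variable bound here cannot be captured: [Q] is lifted past it, so it does not occur in the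
   substituted process. *)
- case/andP=> nocc gP; rewrite IH ?guarded_lift_p // andbT.
  apply/negP=> /(unguarded_occ_psubst (ltn0Sn _)).
  by rewrite (negbTE nocc) unguarded_occ_lift_p.
- by case: ifP.
Qed.

(** A termination measure for unfolding: it counts the conditionals and recursions that stand above
    every communication prefix. *)
Fixpoint head_size (P : process) : nat :=
  match P with
  | PIf _ P1 P2 => (head_size P1 + head_size P2).+1
  | PRec P1 => (head_size P1).+1
  | _ => 0
  end.

(** A guarded variable occurs only below prefixes, where [head_size] does not look. *)
Lemma head_size_psubst k Q P :
  ~~ unguarded_occ k P -> head_size (psubst k Q P) = head_size P.
Proof.
elim: P k Q => //= [e P IH1 P' IH2 | P IH | X] k Q.
- by rewrite negb_or => /andP[/IH1-> /IH2->].
- by move/IH->.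
- by move/negbTE->.
Qed.

(** * Subsorting and subtyping *)

Lemma subsort_trans S2 S1 S3 : subsort S1 S2 -> subsort S2 S3 -> subsort S1 S3.
Proof. by case=> //; inversion 1; constructor. Qed.

Lemma subtype_refl T : subtype T T.
Proof.
move: T; cofix IH; case=> [|p bs|p bs].
- exact: sub_end.
- apply: sub_recv => // l S T S' T' -> [eS eT]; first by rewrite eS; apply: ss_refl.
  by rewrite eT; apply: IH.
- apply: sub_send => // l S T S' T' -> [eS eT]; first by rewrite eS; apply: ss_refl.
  by rewrite eT; apply: IH.
Qed.

(** A label common to the outer types is found in the middle one: for inputs through the right-hand
    inclusion of index sets, for outputs through the left-hand one. *)
Lemma subtype_trans T2 T1 T3 : subtype T1 T2 -> subtype T2 T3 -> subtype T1 T3.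
Proof.
move: T1 T2 T3; cofix IH => T1 T2 T3 [|p bs1 bs2 sub12 ss12 st12|p bs1 bs2 sub12 ss12 st12].
- by [].
- move def2: (LRecv p bs2) => U2 s23.
  case: s23 def2 => // p' bs2' bs3 sub23 ss23 st23 [ep e2].
  rewrite -{}ep; rewrite -{}e2 in sub23 ss23 st23; constructor.
  + by move=> l /sub23/sub12.
  + move=> l S T S' T' l1 l3.
    have [[S2 T2'] l2] := labels_lookup (sub23 _ (lookup_in_labels l3)).
    exact: subsort_trans (ss23 _ _ _ _ _ l2 l3) (ss12 _ _ _ _ _ l1 l2).
  + move=> l S T S' T' l1 l3.
    case: (labels_lookup (sub23 _ (lookup_in_labels l3))) => [[S2 T2'] l2].
    apply: IH (st12 _ _ _ _ _ l1 l2) (st23 _ _ _ _ _ l2 l3).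
- move def2: (LSend p bs2) => U2 s23.
  case: s23 def2 => // p' bs2' bs3 sub23 ss23 st23 [ep e2].
  rewrite -{}ep; rewrite -{}e2 in sub23 ss23 st23; constructor.
  + by move=> l /sub12/sub23.
  + move=> l S T S' T' l1 l3.
    have [[S2 T2'] l2] := labels_lookup (sub12 _ (lookup_in_labels l1)).
    exact: subsort_trans (ss12 _ _ _ _ _ l1 l2) (ss23 _ _ _ _ _ l2 l3).
  + move=> l S T S' T' l1 l3.
    case: (labels_lookup (sub12 _ (lookup_in_labels l1))) => [[S2 T2'] l2].
    apply: IH (st12 _ _ _ _ _ l1 l2) (st23 _ _ _ _ _ l2 l3).
Qed.

Lemma subtype_end_inv T : subtype T LEnd -> T = LEnd.
Proof. by inversion 1. Qed.

Lemma subtype_send_inv q bs U : subtype (LSend q bs) U ->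
  exists2 bs', U = LSend q bs' &
    forall l S T, lookup l bs = Some (S, T) ->
      exists S' T', [/\ lookup l bs' = Some (S', T'), subsort S S' & subtype T T'].
Proof.
inversion 1 as [ | | p' bs1 bs' sub ss st]; subst.
exists bs' => // l S T lbs.
have [[S' T'] lbs'] := labels_lookup (sub _ (lookup_in_labels lbs)).
by exists S', T'; split=> //; [exact: ss lbs lbs' | exact: st lbs lbs'].
Qed.

Lemma subtype_recv_inv p bs U : subtype (LRecv p bs) U ->
  exists2 bs', U = LRecv p bs' &
    forall l S' T', lookup l bs' = Some (S', T') ->
      exists S T, [/\ lookup l bs = Some (S, T), subsort S' S & subtype T T'].
Proof.
inversion 1 as [| p' bs1 bs' sub ss st | ]; subst.
exists bs' => // l S' T' lbs'.
have [[S T] lbs] := labels_lookup (sub _ (lookup_in_labels lbs')).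
by exists S, T; split=> //; [exact: ss lbs lbs' | exact: st lbs lbs'].
Qed.

(** * Expressions *)

Lemma typ_value_weaken Es v S :
  typ_expr [::] (EVal v) S -> typ_expr Es (EVal v) S.
Proof.
move def_e: (EVal v) => e te; elim: te def_e => //= *; try by subst; constructor.
by apply: te_sub; eauto.
Qed.

(** Subsumption puts naturals into [SInt], hence the two alternatives there. *)
Lemma typ_val_inv Es v S : typ_expr Es (EVal v) S ->
  match S with
  | SBool => exists b, v = VBool b
  | SNat => exists n, v = VNat n
  | SInt => (exists z, v = VInt z) \/ (exists n, v = VNat n)
  end.
Proof.
move def_e: (EVal v) => e te.
elim: te def_e => //= [b [->] | z [->] | n [->] | e' S1 S2 _ IH sub /IH]; eauto.
by case: sub => //; right.
Qed.

(** No variable can block a closed expression, and each operator is defined on all values of its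
    operand sort. A choice is resolved to the left. *)
Lemma typ_expr_eval e S :
  typ_expr [::] e S -> exists2 v, eval e v & typ_expr [::] (EVal v) S.
Proof.
elim.
- by case.
- by move=> b; exists (VBool b); constructor.
- by move=> b; exists (VInt b); constructor.
- by move=> b; exists (VNat b); constructor.
- move=> {}e _ [v ev /typ_val_inv[n vn]]; rewrite vn in ev.
  by exists (VNat n.+1); constructor.
- move=> {}e _ [v ev /typ_val_inv[[z vz] | [n vn]]].
    by rewrite vz in ev; exists (VInt (- z)%R); constructor.
  by rewrite vn in ev; exists (VInt (- n%:Z)%R); constructor.
- move=> {}e _ [v ev /typ_val_inv[b vb]]; rewrite vb in ev.
  by exists (VBool (~~ b)); constructor.
- by move=> e1 e2 {}S _ [v ev tv] _ _; exists v => //; constructor.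
- by move=> {}e S1 S2 _ [v ev tv] sub; exists v => //; apply: te_sub sub.
Qed.

(** The index arithmetic of [elift] and [lift_p]. *)
Lemma onth_insert (T : Type) (s1 s2 : seq T) x n :
  onth (s1 ++ x :: s2) (if n < size s1 then n else n.+1) = onth (s1 ++ s2) n.
Proof.
rewrite !onth_cat; case: (ltnP n (size s1)) => n1; first by rewrite n1.
by rewrite ltnNge leqW //= subSn.
Qed.

(** The index arithmetic of [esubst] and [psubst]. *)
Lemma onth_delete (T : Type) (s1 s2 : seq T) x y n :
  onth (s1 ++ x :: s2) n = Some y ->
  if n == size s1 then y = x
  else onth (s1 ++ s2) (if n < size s1 then n else n.-1) = Some y.
Proof.
case: eqP => [-> | /eqP n1]; first by rewrite onth_cat ltnn subnn /= => -[].
rewrite !onth_cat; case: (ltnP n (size s1)) => [-> // | n1'].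
have {n1'} : size s1 < n by rewrite ltn_neqAle eq_sym n1.
case: n {n1} => // n; rewrite ltnS => n1; rewrite /= ltnNge n1 /=.
by rewrite subSn.
Qed.

Lemma typ_expr_lift Es1 Es2 S0 e S : typ_expr (Es1 ++ Es2) e S ->
  typ_expr (Es1 ++ S0 :: Es2) (elift (size Es1) e) S.
Proof.
elim=> //=; try by move=> *; constructor.
- by move=> x {}S xS; apply: te_var; rewrite onth_insert.
- by move=> {}e S1 S2 _ IH sub; apply: te_sub sub.
Qed.

Lemma typ_expr_subst Es1 Es2 S0 v e S :
  typ_expr [::] (EVal v) S0 -> typ_expr (Es1 ++ S0 :: Es2) e S ->
  typ_expr (Es1 ++ Es2) (esubst (size Es1) v e) S.
Proof.
move=> tv; elim=> //=; try by move=> *; constructor.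
- move=> x {}S xS; have := onth_delete xS; case: eqP => _; last exact: te_var.
  by move=> ->; apply: typ_value_weaken.
- by move=> {}e S1 S2 _ IH sub; apply: te_sub sub.
Qed.

(** * Typing of processes *)

(** The prefix [Es1] collects the sorts of the input variables crossed so far, so it must vary in
    the induction. *)
Lemma typ_proc_lift_e Es1 Es2 S0 Ps P T : typ_proc (Es1 ++ Es2) Ps P T ->
  typ_proc (Es1 ++ S0 :: Es2) Ps (lift_e (size Es1) P) T.
Proof.
move def_Es: (Es1 ++ Es2) => Es tP.
elim: tP Es1 def_Es => {Es Ps P T} /=.
- by move=> *; constructor.
- by move=> *; constructor.
- by move=> Es Ps P T _ IH Es1 e1; constructor; apply: IH.
- move=> Es Ps e P1 P2 T te _ IH1 _ IH2 Es1 e1; subst.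
  by constructor; [exact: typ_expr_lift | exact: IH1 | exact: IH2].
- by move=> Es Ps P T T' _ IH sub Es1 e1; apply: tp_sub sub; apply: IH.
- move=> Es Ps p bs ts lab _ IH Es1 e1; apply: tp_recv; first by rewrite labels_bmap.
  move=> l P S T lP lT; have [Q lQ ->] := lookup_bmap_Some lP.
  by apply: (IH _ _ _ _ lQ lT (S :: Es1)); rewrite /= e1.
- move=> Es Ps p l e P S T te _ IH Es1 e1; subst.
  by constructor; [exact: typ_expr_lift | exact: IH].
Qed.

Lemma typ_proc_lift_p Es Ps1 Ps2 T0 P T : typ_proc Es (Ps1 ++ Ps2) P T ->
  typ_proc Es (Ps1 ++ T0 :: Ps2) (lift_p (size Ps1) P) T.
Proof.
move def_Ps: (Ps1 ++ Ps2) => Ps tP.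
elim: tP Ps1 def_Ps => {Es Ps P T} /=.
- by move=> *; constructor.
- by move=> Es Ps X T XT Ps1 e1; constructor; rewrite onth_insert e1.
- by move=> Es Ps P T _ IH Ps1 e1; constructor; apply: (IH (T :: Ps1)); rewrite /= e1.
- by move=> Es Ps e P1 P2 T te _ IH1 _ IH2 Ps1 e1; constructor; auto.
- by move=> Es Ps P T T' _ IH sub Ps1 e1; apply: tp_sub sub; apply: IH.
- move=> Es Ps p bs ts lab _ IH Ps1 e1; apply: tp_recv; first by rewrite labels_bmap.
  move=> l P S T lP lT; have [Q lQ ->] := lookup_bmap_Some lP.
  exact: (IH _ _ _ _ lQ lT).
- by move=> Es Ps p l e P S T te _ IH Ps1 e1; constructor; auto.
Qed.

Lemma typ_proc_vsubst Es1 Es2 S0 Ps v P T :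
  typ_expr [::] (EVal v) S0 -> typ_proc (Es1 ++ S0 :: Es2) Ps P T ->
  typ_proc (Es1 ++ Es2) Ps (vsubst (size Es1) v P) T.
Proof.
move=> tv; move def_Es: (Es1 ++ S0 :: Es2) => Es tP.
elim: tP Es1 def_Es => {Es Ps P T} /=.
- by move=> *; constructor.
- by move=> *; constructor.
- by move=> Es Ps P T _ IH Es1 e1; constructor; apply: IH.
- move=> Es Ps e P1 P2 T te _ IH1 _ IH2 Es1 e1; subst.
  by constructor; [exact: typ_expr_subst te | exact: IH1 | exact: IH2].
- by move=> Es Ps P T T' _ IH sub Es1 e1; apply: tp_sub sub; apply: IH.
- move=> Es Ps p bs ts lab _ IH Es1 e1; apply: tp_recv; first by rewrite labels_bmap.
  move=> l P S T lP lT; have [Q lQ ->] := lookup_bmap_Some lP.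
  by apply: (IH _ _ _ _ lQ lT (S :: Es1)); rewrite /= e1.
- move=> Es Ps p l e P S T te _ IH Es1 e1; subst.
  by constructor; [exact: typ_expr_subst te | exact: IH].
Qed.

(** [Q] varies along with [Ps1] in the induction, since it is lifted under both kinds of binder; the
    two lifting lemmas retype it there. *)
Lemma typ_proc_psubst Es Ps1 Ps2 U Q P T :
  typ_proc Es (Ps1 ++ Ps2) Q U -> typ_proc Es (Ps1 ++ U :: Ps2) P T ->
  typ_proc Es (Ps1 ++ Ps2) (psubst (size Ps1) Q P) T.
Proof.
move=> tQ; move def_Ps: (Ps1 ++ U :: Ps2) => Ps tP.
elim: tP Ps1 Q tQ def_Ps => {Es Ps P T} /=.
- by move=> *; constructor.
- move=> Es Ps X T XT Ps1 Q tQ e1; subst.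
  have := onth_delete XT; case: eqP => _; first by move=> ->.
  exact: tp_var.
- move=> Es Ps P T _ IH Ps1 Q tQ e1; constructor.
  apply: (IH (T :: Ps1)); last by rewrite /= e1.
  exact: (@typ_proc_lift_p _ [::]).
- by move=> Es Ps e P1 P2 T te _ IH1 _ IH2 Ps1 Q tQ e1; constructor; auto.
- by move=> Es Ps P T T' _ IH sub Ps1 Q tQ e1; apply: tp_sub sub; apply: IH.
- move=> Es Ps p bs ts lab _ IH Ps1 Q tQ e1; apply: tp_recv; first by rewrite labels_bmap.
  move=> l P S T lP' lT; have [P' lP ->] := lookup_bmap_Some lP'.
  by apply: (IH _ _ _ _ lP lT) => //; apply: (@typ_proc_lift_e [::]).
- by move=> Es Ps p l e P S T te _ IH Ps1 Q tQ e1; constructor; auto.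
Qed.

(** Subsumption may follow the recursion rule, so the type [U] assumed for the variable is only a
    subtype of [T]. *)
Lemma typ_rec_inv Es Ps P T : typ_proc Es Ps (PRec P) T ->
  exists2 U, typ_proc Es (U :: Ps) P U & subtype U T.
Proof.
move def_Q: (PRec P) => Q tQ; elim: tQ def_Q => // {Es Ps Q T}.
- by move=> Es Ps Q T tQ _ [->]; exists T => //; apply: subtype_refl.
- move=> Es Ps Q T T' _ IH sub /IH[U tP UT].
  by exists U => //; apply: subtype_trans sub.
Qed.

Lemma typ_if_inv Es Ps e P1 P2 T : typ_proc Es Ps (PIf e P1 P2) T ->
  [/\ typ_expr Es e SBool, typ_proc Es Ps P1 T & typ_proc Es Ps P2 T].
Proof.
move def_Q: (PIf e P1 P2) => Q tQ; elim: tQ def_Q => // {Es Ps Q T}.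
- by move=> Es Ps e' P1' P2' T te t1 _ t2 _ [-> -> ->].
- by move=> Es Ps Q T T' _ IH sub /IH[? ? ?]; split=> //; apply: tp_sub sub.
Qed.

Lemma typ_send_inv Es Ps p l e P T : typ_proc Es Ps (PSend p l e P) T ->
  exists S U, [/\ typ_expr Es e S, typ_proc Es Ps P U
    & subtype (LSend p (BOne l (S, U))) T].
Proof.
move def_Q: (PSend p l e P) => Q tQ; elim: tQ def_Q => // {Es Ps Q T}.
- move=> Es Ps Q T T' _ IH sub /IH[S [U [te tP UT]]].
  by exists S, U; split=> //; apply: subtype_trans sub.
- move=> Es Ps p' l' e' P' S T te tP _ [-> -> -> ->].
  by exists S, T; split=> //; apply: subtype_refl.
Qed.

Lemma typ_recv_inv Es Ps p bs T : typ_proc Es Ps (PRecv p bs) T ->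
  exists ts, [/\ labels bs =i labels ts,
    forall l P S U, lookup l bs = Some P -> lookup l ts = Some (S, U) ->
      typ_proc (S :: Es) Ps P U
    & subtype (LRecv p ts) T].
Proof.
move def_Q: (PRecv p bs) => Q tQ; elim: tQ def_Q => // {Es Ps Q T}.
- move=> Es Ps Q T T' _ IH sub /IH[ts [lab tb UT]].
  by exists ts; split=> //; apply: subtype_trans sub.
- move=> Es Ps p' bs' ts lab tb _ [-> ->].
  by exists ts; split=> //; apply: subtype_refl.
Qed.

Lemma typ_end_inv Es Ps T : typ_proc Es Ps PEnd T -> T = LEnd.
Proof.
move def_Q: PEnd => Q tQ; elim: tQ def_Q => // {Es Ps Q T}.
by move=> Es Ps Q T T' _ IH sub /IH eT; move: sub; rewrite eT; inversion 1.
Qed.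

Lemma typ_var_inv Es Ps X T : typ_proc Es Ps (PVar X) T -> X < size Ps.
Proof.
move def_Q: (PVar X) => Q tQ; elim: tQ def_Q => // {Es Ps Q T}.
by move=> Es Ps Y T YT [->]; rewrite -onthTE YT.
Qed.

(** * Sessions *)

(** In this recursive form invariance under [scong] is mere propositional logic, whereas
    [components] is preserved only up to permutation. *)
Fixpoint sess_all (A : participant -> process -> Prop) (M : session) : Prop :=
  match M with
  | SPart p P => A p P
  | SPar M1 M2 => sess_all A M1 /\ sess_all A M2
  | SNil => True
  end.

Lemma sess_allP A M : sess_all A M <->
  forall i p P, onth (components M) i = Some (p, P) -> A p P.
Proof.
elim: M => [p P | M1 IH1 M2 IH2 |] /=.
- split=> [AP i p' P' /onth1P[_ [<- <-]] // | /(_ 0 p P)]; exact.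
- split=> [[/IH1 A1 /IH2 A2] i p P | A12].
    by rewrite onth_cat; case: ifP => _; [apply: A1 | apply: A2].
  split; [apply/IH1 | apply/IH2] => i p P iP.
    by apply: (A12 i); rewrite onth_cat -onthTE iP.
  by apply: (A12 (size (components M1) + i)); rewrite onth_cat ltnNge leq_addr addKn.
- by split=> // _ i p P; rewrite onth0n.
Qed.

Lemma guarded_sessionE M :
  guarded_session M <-> sess_all (fun _ P => guarded P) M.
Proof.
rewrite /guarded_session; elim: M => [p P | M1 IH1 M2 IH2 |] //=.
  by rewrite andbT.
by rewrite all_cat; split=> [/andP[/IH1 ? /IH2 ?] | [/IH1 ? /IH2 ?]]; [| apply/andP].
Qed.

Lemma sess_allI (A B : participant -> process -> Prop) M :
  sess_all A M -> sess_all B M -> sess_all (fun p P => A p P /\ B p P) M.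
Proof. by elim: M => //= M1 IH1 M2 IH2 [? ?] [? ?]; split; [exact: IH1 | exact: IH2]. Qed.

Lemma sess_all_impl (A B : participant -> process -> Prop) M :
  (forall p P, p \in participants M -> A p P -> B p P) ->
  sess_all A M -> sess_all B M.
Proof.
rewrite /participants; elim: M => [p P | M1 IH1 M2 IH2 |] //= AB.
  by apply: AB; rewrite inE.
move: AB; rewrite map_cat => AB [A1 A2]; split; [apply: IH1 A1 | apply: IH2 A2];
  by move=> p P pM; apply: AB; rewrite mem_cat pM ?orbT.
Qed.

Lemma scong_sess_all A M N : scong M N -> sess_all A M <-> sess_all A N.
Proof. by elim=> //=; intuition. Qed.

Lemma scong_participants M N :
  scong M N -> perm_eq (participants M) (participants N).
Proof.
rewrite /participants; elim=> //= {M N}.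
- by move=> M N _; rewrite perm_sym.
- by move=> L M N _ LM _; apply: perm_trans.
- by move=> M M' N N' _ h1 _ h2; rewrite !map_cat perm_cat.
- by move=> M N; rewrite !map_cat perm_catC.
- by move=> L M N; rewrite !map_cat catA.
- by move=> M; rewrite cats0.
Qed.

(** Brings a component to the front, the place where the unfolding rules act. *)
Lemma scong_split p M : p \in participants M ->
  exists P N, scong M (SPar (SPart p P) N).
Proof.
rewrite /participants; elim: M => [p' P | M1 IH1 M2 IH2 |] //=.
- rewrite inE => /eqP->; exists P, SNil; exact: sc_sym (sc_nil _).
- rewrite map_cat mem_cat => /orP[/IH1 | /IH2] [P [N MN]].
    exists P, (SPar N M2).
    exact: sc_trans (sc_par MN (sc_refl _)) (sc_assoc _ _ _).
  exists P, (SPar N M1); apply: sc_trans (sc_comm _ _) _.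
  exact: sc_trans (sc_par MN (sc_refl _)) (sc_assoc _ _ _).
Qed.

Definition head_normal (P : process) : bool :=
  match P with
  | PIf _ _ _ | PRec _ | PVar _ => false
  | _ => true
  end.

(* Guardedness makes [head_size] drop at every unfolding. *)
Lemma unfolds_head_normal p P T N :
  guarded P -> typ_proc [::] [::] P T ->
  exists P', [/\ head_normal P', guarded P', typ_proc [::] [::] P' T
    & unfolds (SPar (SPart p P) N) (SPar (SPart p P') N)].
Proof.
have [n] := ubnP (head_size P); elim: n P => // n IH P le_n gP tP.
have [hP | ] := boolP (head_normal P).
  by exists P; split=> //; apply/un_struct/sc_refl.
case: P gP tP le_n => //=.
- move=> e P1 P2 /andP[g1 g2] /typ_if_inv[te t1 t2] le_n _.
  have [v ev /typ_val_inv[b eb]] := typ_expr_eval te.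
  rewrite {v}eb in ev; case: b ev => ev.
    have [|P' [hP' gP' tP' un]] := IH P1 _ g1 t1; first by lia.
    by exists P'; split=> //; apply: un_trans un; apply: un_true.
  have [|P' [hP' gP' tP' un]] := IH P2 _ g2 t2; first by lia.
  by exists P'; split=> //; apply: un_trans un; apply: un_false.
- move=> P gP tP le_n _; have /andP[nocc gP1] := gP.
  have [U tU UT] := typ_rec_inv tP.
  have [|||P' [hP' gP' tP' un]] := IH (psubst 0 (PRec P) P).
  + by rewrite head_size_psubst.
  + exact: guarded_psubst.
  (* With its variable at [U] the body has type [U]; so do the recursion and its unfolding, and
     subsumption leads to [T]. *)
  + apply: tp_sub UT; apply: (@typ_proc_psubst _ [::] _ U) => //.
    exact: tp_rec.
  by exists P'; split=> //; apply: un_trans un; apply: un_rec.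
- by move=> X _ /typ_var_inv.
Qed.

(** * Transitions of environments *)

(** The freshness and disjointness premises ensure that framing and union overwrite no entry
    involved in the action. *)
Lemma env_step_fnd Gamma a Gamma' : env_step Gamma a Gamma' ->
  match a with
  | ARecv p q _ _ => exists bs, Gamma.[? p]%fmap = Some (LRecv q bs)
  | ASend p q _ _ => exists bs, Gamma.[? p]%fmap = Some (LSend q bs)
  | AComm p q _ =>
      (exists bs, Gamma.[? p]%fmap = Some (LSend q bs)) /\
      (exists bs, Gamma.[? q]%fmap = Some (LRecv p bs))
  end.
Proof.
have dom_fnd (f : env) x T : f.[? x]%fmap = Some T -> x \in domf f.
  by move=> xT; rewrite -fndSome xT.
elim=> {Gamma a Gamma'}.
- by move=> p q bs l S T _; exists bs; rewrite fnd_set eqxx.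
- by move=> p q bs l S T _; exists bs; rewrite fnd_set eqxx.
- move=> Gamma Gamma' a p T _ IH pG _.
  have keep x U : Gamma.[? x]%fmap = Some U -> (Gamma.[p <- T]).[? x]%fmap = Some U.
    move=> xU; rewrite fnd_set; case: eqP => // xp.
    by move: pG; rewrite -xp (dom_fnd _ _ _ xU).
  case: a IH => [x y l S [bs e] | x y l S [bs e] | x y l [[bs e] [bs' e']]].
  + by exists bs; apply: keep.
  + by exists bs; apply: keep.
  + by split; [exists bs | exists bs']; apply: keep.
(* The right operand of a union takes precedence: the entry of [q] survives outright, that of [p] by
   disjointness. *)
- move=> G1 G1' G2 G2' p q l S S' _ [bs e] _ [bs' e'] _ dis _; split.
    exists bs; rewrite fnd_cat ifN //.
    by apply: contraL (dom_fnd _ _ _ e) => p2; move: dis; rewrite fdisjoint_sym => /fdisjointP/(_ _ p2).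
  by exists bs'; rewrite fnd_cat (dom_fnd _ _ _ e').
Qed.

(** The rule for communication yields the step on the two-entry environment; the other participants
    are added one at a time by framing, whence the induction on the size of the domain. *)
Lemma env_step_comm (Gamma : env) p q l bs bs' S S' T T' :
  Gamma.[? p]%fmap = Some (LSend q bs) -> Gamma.[? q]%fmap = Some (LRecv p bs') ->
  lookup l bs = Some (S, T) -> lookup l bs' = Some (S', T') -> subsort S S' ->
  env_step Gamma (AComm p q l) Gamma.[p <- T].[q <- T']%fmap.
Proof.
move=> Gp Gq lbs lbs' sub.
have pq : p != q by apply/eqP=> epq; move: Gp; rewrite epq Gq.
have [n] := ubnP #|` domf Gamma|%fset; elim: n Gamma Gp Gq => // n IH Gamma Gp Gq.
rewrite ltnS => le_n.
have [E | /fset0Pn[k]] := eqVneq (domf Gamma `\` [fset p; q])%fset fset0.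
  have eG : Gamma = ([fmap].[p <- LSend q bs]%fmap + [fmap].[q <- LRecv p bs']%fmap)%fset.
    apply/fmapP => k; rewrite fnd_cat !fnd_set dom_setf !inE /=.
    case: (eqVneq k q) => [-> // | kq]; case: (eqVneq k p) => [-> // | kp].
    rewrite fnd_fmap0; apply: not_fnd; apply/negP => kG.
    have : k \in (domf Gamma `\` [fset p; q])%fset by rewrite !inE (negbTE kp) (negbTE kq).
    by rewrite E.
  have eG' : Gamma.[p <- T].[q <- T']%fmap = ([fmap].[p <- T]%fmap + [fmap].[q <- T']%fmap)%fset.
    apply/fmapP => k; rewrite eG !fnd_set !fnd_cat !fnd_set !dom_setf !inE /=.
    by case: (eqVneq k q) => // kq; case: (eqVneq k p).
  rewrite eG' {1}eG.
  apply: E_comm (E_send _ _ lbs) (E_recv _ _ lbs') sub _ _;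
    by rewrite !dom_setf !fsetU0 fdisjointX1 inE eq_sym.
(* A bystander [k] is removed from [Gamma] and restored by [E_frame]. *)
rewrite !inE negb_or => /andP[/andP[kp kq] kG].
have dom_rem1 : domf Gamma.[~ k]%fmap = (domf Gamma `\ k)%fset.
  by apply/fsetP => x; rewrite mem_remf1 !inE.
have [U GU] : exists U, Gamma.[? k]%fmap = Some U by exists (Gamma.[kG]%fmap); apply: in_fnd.
have eG : Gamma = (Gamma.[~ k].[k <- U])%fmap.
  apply/fmapP => x; rewrite fnd_set fnd_rem1; by case: eqVneq => // ->.
have eG' : Gamma.[p <- T].[q <- T']%fmap
    = (Gamma.[~ k].[p <- T].[q <- T'].[k <- U])%fmap.
  apply/fmapP => x; rewrite !fnd_set fnd_rem1.
  by case: (eqVneq x k) => // ->; rewrite GU (negbTE kp) (negbTE kq).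
rewrite eG' {1}eG; apply: E_frame.
- apply: IH; rewrite ?fnd_rem1 1?eq_sym ?kp ?kq //.
  apply: leq_trans le_n.
  by rewrite (cardfsD1 k (domf Gamma)) kG dom_rem1 /=.
- by rewrite dom_rem1 !inE eqxx.
- by rewrite !dom_setf dom_rem1 !inE eqxx (negbTE kp) (negbTE kq).
Qed.

(** * Projections *)

Lemma proj_notin r G U : proj r G U -> ~ in_pt r G -> U = LEnd.
Proof.
case=> // [p bs ts _ _ _ [] | q bs ts _ _ _ []]; [exact: pt_receiver | exact: pt_sender].
Qed.

(** Induction on the occurrence of [r]: the node where [r] acts never projects to [LEnd], and a
    skipped node passes [LEnd] on to the continuation. *)
Lemma proj_end_notin r G : proj r G LEnd -> ~ in_pt r G.
Proof.
move=> prG inG; elim: inG prG => [q bs | p bs | p q bs l S {}G lG inG IH] prG.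
- by inversion prG as [? ninG | | | ]; [apply: ninG; apply: pt_sender |].
- by inversion prG as [? ninG | | | ]; [apply: ninG; apply: pt_receiver |].
- inversion prG as [? ninG | | | ? ? ? ? _ _ _ prch]; first by apply: ninG; apply: pt_cont lG inG.
  by subst; apply: IH; apply: prch lG.
Qed.

Lemma proj_in r G U : proj r G U -> U <> LEnd -> in_pt r G.
Proof. by case=> // *; constructor. Qed.

(** The membership premise of [proj_skip] comes for free. If [T] is not [LEnd], then [r] occurs in a
    continuation, and there is at least one; if it is, then [r] occurs in none, and [proj_end]
    applies. *)
Lemma proj_skip_all r p q bs T : r <> p -> r <> q ->
  (forall l S G, lookup l bs = Some (S, G) -> proj r G T) ->
  proj r (GComm p q bs) T.
Proof.
move=> rp rq prch.
have skip : T <> LEnd -> proj r (GComm p q bs) T.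
  move=> nT; apply: proj_skip => //.
  have [l [[S G] lG]] := lookup_nonempty bs.
  exact: pt_cont lG (proj_in (prch _ _ _ lG) nT).
case: T prch skip => [prch _ | p' bs' _ skip | p' bs' _ skip]; try exact: skip.
apply: proj_end => inG; inversion inG as [| | ? ? ? l S G lG inG']; subst => //.
by apply: proj_end_notin inG'; apply: prch lG.
Qed.

Lemma proj_skip_inv r p q bs T l S G : r <> p -> r <> q ->
  proj r (GComm p q bs) T -> lookup l bs = Some (S, G) -> proj r G T.
Proof.
move=> rp rq prG lG; inversion prG as [? ninG | | | ? ? ? ? _ _ _ prch]; subst => //.
- by apply: proj_end => inG; apply: ninG; apply: pt_cont lG inG.
- exact: prch lG.
Qed.

Lemma projectable_cont p q bs l S G :
  projectable (GComm p q bs) -> lookup l bs = Some (S, G) -> projectable G.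
Proof.
move=> prG lG r; have [U prU] := prG r.
inversion prU as [? ninG | ? ? ts lab _ prch | ? ? ts lab _ prch | ? ? ? ? _ _ _ prch]; subst.
- by exists LEnd; apply: proj_end => inG; apply: ninG; apply: pt_cont lG inG.
- have [[S' T] lT] : exists a, lookup l ts = Some a.
    by apply: labels_lookup; rewrite -lab; apply: lookup_in_labels lG.
  by exists T; apply: prch lG lT.
- have [[S' T] lT] : exists a, lookup l ts = Some a.
    by apply: labels_lookup; rewrite -lab; apply: lookup_in_labels lG.
  by exists T; apply: prch lG lT.
- by exists U; apply: prch lG.
Qed.

(** Each of the two projections names the other participant as partner, so neither can act at the
    root without the other. *)
Lemma proj_send_recv_head p q p0 q0 bs gp gq :
  proj p (GComm p0 q0 bs) (LSend q gp) -> proj q (GComm p0 q0 bs) (LRecv p gq) ->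
  [/\ p0 = p, q0 = q & forall l S T, lookup l gp = Some (S, T) ->
     exists G T', [/\ lookup l bs = Some (S, G), lookup l gq = Some (S, T'),
                      proj p G T & proj q G T']]
  \/ [/\ p <> p0, p <> q0, q <> p0 & q <> q0].
Proof.
move=> prp prq.
inversion prp as [ | | ? ? ? labp Sp prchp | ? ? ? ? pp0 pq0 _ _]; subst.
- left; inversion prq as [ | ? ? ? labq Sq prchq | | ]; subst => //.
  split=> // l S T lT.
  have [[S1 G] lG] : exists a, lookup l bs = Some a.
    by apply: labels_lookup; rewrite labp; apply: lookup_in_labels lT.
  have [[S' T'] lT'] : exists a, lookup l gq = Some a.
    by apply: labels_lookup; rewrite -labq; apply: lookup_in_labels lG.
  have eS := Sp _ _ _ _ _ lG lT; have eS' := Sq _ _ _ _ _ lG lT'; subst.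
  by exists G, T'; split=> //; [exact: prchp lG lT | exact: prchq lG lT'].
- by right; inversion prq; subst.
Qed.

(** An occurrence of [p] lies at finite depth even in an infinite tree. Skipped nodes keep both
    projections, and a node p -> q gives them the same labels and sorts. *)
Lemma proj_dual p q G gp gq l S T :
  proj p G (LSend q gp) -> proj q G (LRecv p gq) -> lookup l gp = Some (S, T) ->
  exists T', lookup l gq = Some (S, T').
Proof.
move=> prp prq lT; have inG : in_pt p G by apply: proj_in prp _.
elim: inG prp prq => [q0 bs | p0 bs | p0 q0 bs l' S' {}G lG _ IH] prp prq;
  have [[_ _ dual] | [pp0 pq0 qp0 qq0]] := proj_send_recv_head prp prq => //;
  try by have [? [T' [_ lT' _ _]]] := dual _ _ _ lT; exists T'.
by apply: IH; [exact: proj_skip_inv prp lG | exact: proj_skip_inv prq lG].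
Qed.

(** * Balance and well-formedness *)

Lemma subtree_cont p q bs l S G G' :
  lookup l bs = Some (S, G) -> subtree G' G -> subtree G' (GComm p q bs).
Proof. by move=> lG [w Gw]; exists ((p, q) :: w); apply: gp_cons lG Gw. Qed.

Lemma subtree_comm_inv p q bs G' : subtree G' (GComm p q bs) ->
  G' = GComm p q bs \/ exists l S G, lookup l bs = Some (S, G) /\ subtree G' G.
Proof.
case=> w Gw; inversion Gw as [| ? ? ? l S G w' ? lG Gw']; subst; first by left.
by right; exists l, S, G; split=> //; exists w'.
Qed.

Lemma balanced_cont p q bs l S G :
  balanced (GComm p q bs) -> lookup l bs = Some (S, G) -> balanced G.
Proof. by move=> bal lG G' sub; apply: bal; apply: subtree_cont lG sub. Qed.

Lemma gwf_cont p q bs l S G :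
  gwf (GComm p q bs) -> lookup l bs = Some (S, G) -> gwf G.
Proof. by move=> wf lG p' q' bs' sub; apply: (wf _ _ bs'); apply: subtree_cont lG sub. Qed.

Lemma gwf_comm p q bs : p <> q ->
  (forall l S G, lookup l bs = Some (S, G) -> gwf G) -> gwf (GComm p q bs).
Proof.
move=> pq wf p' q' bs' /subtree_comm_inv[[-> -> _] // | [l [S [G [lG sub]]]]].
exact: wf lG _ _ _ sub.
Qed.

(* A participant of a projectable node that does not act at the node takes part
   in all of its continuations, so the maximum of their bounds, plus one, works. *)
Lemma balanced_comm p q bs : projectable (GComm p q bs) ->
  (forall l S G, lookup l bs = Some (S, G) -> balanced G) ->
  balanced (GComm p q bs).
Proof.
move=> prG bal G' /subtree_comm_inv[-> | [l [S [G [lG sub]]]]]; last exact: bal lG _ sub.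
pose bnd k (a : Defs.sort * gtype) := forall r, in_pt r a.2 ->
  forall w G'', gpath a.2 w G'' -> (k <= size w \/ G'' = GEnd) -> occurs_on r w.
have [k bndk] : exists k, forall l a, lookup l bs = Some a -> bnd k a.
  apply: lookup_uniform_bound => [k k' a kk' bk r inr w G'' Gw [kw | end_]|l [S G] lG].
  - by apply: bk Gw _ => //; left; apply: leq_trans kw.
  - by apply: bk Gw _ => //; right.
  - by have [|k bk] := bal _ _ _ lG G; [exists [::]; exact: gp_nil | exists k].
exists k.+1 => r inr w G'' Gw.
(* The empty path is excluded: it is shorter than [k.+1] and ends at a communication. *)
inversion Gw as [| ? ? ? l S G w' ? lG Gw']; subst; first by case.
rewrite /occurs_on /=; case: eqP => //= rp; case: eqP => //= rq kw.
apply: (bndk _ _ lG r _ _ _ Gw'); last by case: kw; [left | right].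
have [U prU] := prG r.
apply: (proj_in (proj_skip_inv rp rq prU lG)) => eU.
by move: inr; apply: proj_end_notin; rewrite -eU.
Qed.

(** * Reduction of global types *)

(* The number [n] bounds the depth at which p -> q is searched for; the [GEnd]
   results are junk values, for a missing label or a depth that is too small. *)
Fixpoint greduce (p q : participant) (l : label) (n : nat) (G : gtype) : gtype :=
  match n, G with
  | n0.+1, GComm p0 q0 bs =>
      if (p0 == p) && (q0 == q) then
        (if lookup l bs is Some a then a.2 else GEnd)
      else GComm p0 q0 (bmap (fun a => (a.1, greduce p q l n0 a.2)) bs)
  | _, _ => GEnd
  end.

(** What [balanced] gives at the root for one participant, with the bound made explicit so that it
    can decrease along the tree. *)
Definition reached_within (p : participant) (n : nat) (G : gtype) : Prop :=
  forall w G', gpath G w G' -> (n <= size w \/ G' = GEnd) -> occurs_on p w.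

Lemma reached_within_cont r n p q bs l S G : r <> p -> r <> q ->
  reached_within r n.+1 (GComm p q bs) -> lookup l bs = Some (S, G) ->
  reached_within r n G.
Proof.
move=> rp rq reach lG w G' Gw nw.
have := reach ((p, q) :: w) G' (gp_cons p q lG Gw).
by rewrite /occurs_on /=; case: eqP => //= _; case: eqP => //= _; apply.
Qed.

(** The claims are proved together because they feed each other: balance of the new node uses its
    projectability, which uses the projections, and a participant absent from the old node must stay
    absent to keep [LEnd]. *)
Lemma greduce_spec p q l gp gq S S' Tp Tq n G :
  lookup l gp = Some (S, Tp) -> lookup l gq = Some (S', Tq) ->
  reached_within p n G -> balanced G -> gwf G -> projectable G ->
  proj p G (LSend q gp) -> proj q G (LRecv p gq) ->
  [/\ balanced (greduce p q l n G), gwf (greduce p q l n G),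
      proj p (greduce p q l n G) Tp, proj q (greduce p q l n G) Tq
    & (forall r U, r <> p -> r <> q -> proj r G U -> proj r (greduce p q l n G) U)
      /\ (forall r, in_pt r (greduce p q l n G) -> in_pt r G)].
Proof.
move=> lp lq; elim: n G => [|n IH] G reach bal wf prG prp prq.
  (* At bound 0 even the empty path would have to mention [p], so the junk value is never met. *)
  by have := reach [::] G (gp_nil G); rewrite leq0n => /(_ (or_introl isT)).
case: G reach bal wf prG prp prq => [_ _ _ _ prp | p0 q0 bs reach bal wf prG prp prq].
  by inversion prp.
have [[ep eq dual] | [pp0 pq0 qp0 qq0]] := proj_send_recv_head prp prq.
  subst p0 q0; rewrite /= !eqxx /=.
  have [G1 [T' [lG lT' prG1 prG1']]] := dual _ _ _ lp; rewrite lG.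
  have eT : T' = Tq by move: lT'; rewrite lq => -[].
  rewrite -eT; split=> //.
  - exact: balanced_cont bal lG.
  - exact: gwf_cont wf lG.
  - split=> [r U rp rq prU | r]; first exact: proj_skip_inv prU lG.
    exact: pt_cont lG.
(* Neither [p] nor [q] acts here: both skip the node, and the reduction goes into every branch. *)
rewrite /= (introF eqP (fun e => pp0 (esym e))) /=.
set bs' := bmap _ bs.
have lookup_bs' l1 S1 G1 : lookup l1 bs = Some (S1, G1) ->
    lookup l1 bs' = Some (S1, greduce p q l n G1).
  by move=> lG; rewrite lookup_bmap lG.
have lookup_bs l1 S1 G1' : lookup l1 bs' = Some (S1, G1') ->
    exists2 G1, lookup l1 bs = Some (S1, G1) & G1' = greduce p q l n G1.
  move=> lG; have [[S2 G2] lG2 [-> ->]] := lookup_bmap_Some lG.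
  by exists G2.
have IHbs l1 S1 G1 (lG : lookup l1 bs = Some (S1, G1)) := IH G1
  (reached_within_cont pp0 pq0 reach lG) (balanced_cont bal lG) (gwf_cont wf lG)
  (projectable_cont prG lG) (proj_skip_inv pp0 pq0 prp lG)
  (proj_skip_inv qp0 qq0 prq lG).
have in_red r : in_pt r (GComm p0 q0 bs') -> in_pt r (GComm p0 q0 bs).
  move=> inr; inversion inr as [| | ? ? ? l1 S1 G1 lG1 inG1]; subst; try by constructor.
  have [G2 lG2 eG] := lookup_bs _ _ _ lG1; subst G1.
  have [_ _ _ _ [_ in2]] := IHbs _ _ _ lG2.
  by apply: pt_cont lG2 _; apply: in2.
have prp' : proj p (GComm p0 q0 bs') Tp.
  apply: proj_skip_all => // l1 S1 G1 /lookup_bs[G2 lG2 ->].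
  by have [] := IHbs _ _ _ lG2.
have prq' : proj q (GComm p0 q0 bs') Tq.
  apply: proj_skip_all => // l1 S1 G1 /lookup_bs[G2 lG2 ->].
  by have [] := IHbs _ _ _ lG2.
have prr r U : r <> p -> r <> q -> proj r (GComm p0 q0 bs) U -> proj r (GComm p0 q0 bs') U.
  move=> rp rq prU.
  inversion prU as [? ninG | ? ? ts lab eqS prch | ? ? ts lab eqS prch | ? ? ? ? rp0 rq0 _ prch]; subst.
  - by apply: proj_end => /in_red.
  - apply: proj_recv; first by rewrite labels_bmap.
      move=> l1 S1 G1 S2 T2 /lookup_bs[G2 lG2 _]; exact: eqS lG2.
    move=> l1 S1 G1 S2 T2 /lookup_bs[G2 lG2 ->] lT2.
    have [_ _ _ _ [prG2 _]] := IHbs _ _ _ lG2.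
    by apply: prG2 => //; apply: prch lG2 lT2.
  - apply: proj_send; first by rewrite labels_bmap.
      move=> l1 S1 G1 S2 T2 /lookup_bs[G2 lG2 _]; exact: eqS lG2.
    move=> l1 S1 G1 S2 T2 /lookup_bs[G2 lG2 ->] lT2.
    have [_ _ _ _ [prG2 _]] := IHbs _ _ _ lG2.
    by apply: prG2 => //; apply: prch lG2 lT2.
  - apply: proj_skip_all => // l1 S1 G1 /lookup_bs[G2 lG2 ->].
    have [_ _ _ _ [prG2 _]] := IHbs _ _ _ lG2.
    by apply: prG2 => //; apply: prch lG2.
split=> //.
- apply: balanced_comm => [r | l1 S1 G1 /lookup_bs[G2 lG2 ->]]; last by have [] := IHbs _ _ _ lG2.
  case: (r =P p) => [-> | rp]; first by exists Tp.
  case: (r =P q) => [-> | rq]; first by exists Tq.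
  by have [U prU] := prG r; exists U; apply: prr.
- apply: gwf_comm => [|l1 S1 G1 /lookup_bs[G2 lG2 ->]]; last by have [] := IHbs _ _ _ lG2.
  by apply: (wf _ _ bs); exists [::]; apply: gp_nil.
Qed.

Lemma global_comm p q l gp gq S S' Tp Tq G :
  lookup l gp = Some (S, Tp) -> lookup l gq = Some (S', Tq) ->
  balanced G -> gwf G -> projectable G ->
  proj p G (LSend q gp) -> proj q G (LRecv p gq) ->
  exists G', [/\ [/\ balanced G', gwf G' & projectable G'],
    proj p G' Tp, proj q G' Tq,
    forall r U, r <> p -> r <> q -> proj r G U -> proj r G' U
    & forall r, in_pt r G' -> in_pt r G].
Proof.
move=> lp lq bal wf prG prp prq.
have [|k bk] := bal G; first by exists [::]; apply: gp_nil.
have reach : reached_within p k G.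
  by move=> w G'; apply: bk; apply: proj_in prp _.
have [bal' wf' prp' prq' [prr in_red]] := greduce_spec lp lq reach bal wf prG prp prq.
exists (greduce p q l k G); split=> //; split=> // r.
case: (r =P p) => [-> | rp]; first by exists Tp.
case: (r =P q) => [-> | rq]; first by exists Tq.
by have [U prU] := prG r; exists U; apply: prr.
Qed.

(** Bystanders keep type and projection. Whoever is absent from [G'] projects to [LEnd] there, and
    only [LEnd] is a subtype of [LEnd]; this covers participants that the reduction has made
    disappear. *)
Lemma assoc_comm Gamma G G' p q Tp Tq Up Uq :
  assoc Gamma G ->
  proj p G' Up -> subtype Tp Up -> proj q G' Uq -> subtype Tq Uq ->
  (forall r U, r <> p -> r <> q -> proj r G U -> proj r G' U) ->
  (forall r, in_pt r G' -> in_pt r G) ->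
  assoc Gamma.[p <- Tp].[q <- Tq]%fmap G'.
Proof.
move=> [asc_in asc_out] prp subp prq subq prr in_red; split=> r inr; rewrite !fnd_set.
  case: eqP => [-> | rq]; first by exists Tq, Uq.
  case: eqP => [-> | rp]; first by exists Tp, Up.
  have [T [U [GT prU sub]]] := asc_in _ (in_red _ inr).
  by exists T, U; split=> //; apply: prr.
case: eqP => [rq | rq].
  right; rewrite rq in inr; move: subq; rewrite (proj_notin prq inr).
  by move/subtype_end_inv->.
case: eqP => [rp | rp].
  right; rewrite rp in inr; move: subp; rewrite (proj_notin prp inr).
  by move/subtype_end_inv->.
case GT: (Gamma.[? r]%fmap) => [T|]; last by left.
(* If [r] took part in [G], its projection would carry over to [G'], where it is [LEnd], forcing [T]
   to be [LEnd]. Membership in [G] need not be decided. *)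
have ninr : T <> LEnd -> ~ in_pt r G.
  move=> nT /asc_in[T' [U [GT' prU sub]]]; apply: nT.
  have eT : T' = T by move: GT'; rewrite GT => -[].
  apply: subtype_end_inv; rewrite -(proj_notin (prr _ _ rp rq prU) inr) -eT.
  exact: sub.
by case: T GT ninr => [| p' bs | p' bs] GT ninr; right => //;
  have [] := asc_out r (ninr _); rewrite // GT.
Qed.

Theorem mainTheorem6 (Gamma Gamma' : env) (M : session)
    (p q : participant) (l : label)
    (guardedM : guarded_session M)
    (typM : typ_sess Gamma M)
    (stepGamma : env_step Gamma (AComm p q l) Gamma') :
  exists (l' : label) (Gamma'' : env) (M' : session),
    [/\ guarded_session M',
        sred M p q l' M',
        env_step Gamma (AComm p q l') Gamma''
      & typ_sess Gamma'' M'].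
Proof.
have [[tp Gp] [tq Gq]] := env_step_fnd stepGamma.
have pq : p != q by apply/eqP=> epq; move: Gp; rewrite epq Gq.
have [uniqM typcM [G [balG wfG prG ascG ptG]]] := typM.
have [asc_in asc_out] := ascG.
(* Association only refutes absence from [G]; the projection of [r], which exists, then turns this
   double negation into membership. *)
have notout r T : Gamma.[? r]%fmap = Some T -> T <> LEnd -> ~ ~ in_pt r G.
  by move=> GT nT /asc_out; rewrite GT => -[// | [/nT]].
have assoc_proj r T : Gamma.[? r]%fmap = Some T -> T <> LEnd ->
    [/\ r \in participants M & exists2 U, proj r G U & subtype T U].
  move=> GT nT; have [U prU] := prG r.
  have inr : in_pt r G.
    apply: (proj_in prU) => eU; apply: (notout _ _ GT nT).
    by apply: proj_end_notin; rewrite -eU.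
  have [T' [U' [GT' prU' sub]]] := asc_in _ inr.
  split; first exact: ptG.
  by exists U' => //; move: GT'; rewrite GT => -[->].
have [|pM [Up prp subp]] := assoc_proj _ _ Gp; first by [].
have [|qM [Uq prq subq]] := assoc_proj _ _ Gq; first by [].
have [gp eUp subp'] := subtype_send_inv subp; subst Up.
have [gq eUq subq'] := subtype_recv_inv subq; subst Uq.
have [P [N1 scM1]] := scong_split pM.
have [Q [N scN1]] : exists Q N, scong N1 (SPar (SPart q Q) N).
  apply: scong_split; have := perm_mem (scong_participants scM1) q.
  by rewrite qM /participants /= inE eq_sym (negbTE pq) => /esym.
have scM : scong M (SPar (SPart p P) (SPar (SPart q Q) N)).
  exact: sc_trans scM1 (sc_par (sc_refl _) scN1).
have permM : perm_eq (participants M) [:: p, q & participants N].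
  exact: scong_participants scM.
have allM : sess_all (fun r R => guarded R /\
    exists2 T, Gamma.[? r]%fmap = Some T & typ_proc [::] [::] R T) M.
  by apply: sess_allI; [exact/guarded_sessionE | exact/sess_allP].
have /= [[gP [TP GTP tP]] [[gQ [TQ GTQ tQ]] allN]] := (scong_sess_all _ scM).1 allM.
have eTP : TP = LSend q tp by move: GTP; rewrite Gp => -[].
have eTQ : TQ = LRecv p tq by move: GTQ; rewrite Gq => -[].
subst TP TQ.
have [P' [hP' gP' tP' unP]] := unfolds_head_normal p (SPar (SPart q Q) N) gP tP.
have [Q' [hQ' gQ' tQ' unQ]] := unfolds_head_normal q (SPar (SPart p P') N) gQ tQ.
(* Inverting typing and subtyping leaves only an output at an output type. *)
case: P' hP' gP' tP' unP unQ => // [q' l' e P1 | p' bs | ] _ gP' tP' unP unQ; last first.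
- by have := typ_end_inv tP'.
- by have [ts [_ _ sub]] := typ_recv_inv tP'; inversion sub.
have [Se [U [te tP1 sub_tp]]] := typ_send_inv tP'.
have [tp' etp subtp] := subtype_send_inv sub_tp; case: etp => eq etp; subst q' tp'.
(* The label [l'] travels from the process of [p] up to the projection on [p], across by duality,
   and down to the process of [q]. The sorts met on the way increase: [Se], [S1], [Sg], [S2],
   [S3]. *)
have [|S1 [T1 [l_tp Se1 UT1]]] := subtp l' Se U; first by rewrite /= eqxx.
have [Sg [Tgp [l_gp S1g T1g]]] := subp' _ _ _ l_tp.
have [Tgq l_gq] := proj_dual prp prq l_gp.
have [S2 [T2 [l_tq Sg2 T2g]]] := subq' _ _ _ l_gq.
case: Q' hQ' gQ' tQ' unQ => // [q' l1 e' P2 | p' bs | ] _ gQ' tQ' unQ; last first.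
- by have := typ_end_inv tQ'.
- have [ts [lab tbs sub_tq]] := typ_recv_inv tQ'.
  have [tq' etq subtq] := subtype_recv_inv sub_tq; case: etq => ep etq; subst p' tq'.
  have [S3 [T3 [l_ts S23 T32]]] := subtq _ _ _ l_tq.
  have [Q1 l_bs] : exists Q1, lookup l' bs = Some Q1.
    by apply: labels_lookup; rewrite lab; apply: lookup_in_labels l_ts.
  have [v ev tv] := typ_expr_eval te.
  have [G' [[bal' wf' prG'] prp' prq' prr in_red]] :=
    global_comm l_gp l_gq balG wfG prG prp prq.
  pose M' := SPar (SPar (SPart q (vsubst 0 v Q1)) (SPart p P1)) N.
  have permM' : perm_eq (participants M) (participants M').
    apply: perm_trans permM _.
    exact: (permEl (perm_catCA [:: p] [:: q] (participants N))).
  have uniqM' : uniq (participants M') by rewrite -(perm_uniq permM').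
  have tQ1 : typ_proc [::] [::] (vsubst 0 v Q1) T2.
    apply: tp_sub T32; apply: (@typ_proc_vsubst [::] [::] S3).
      apply: te_sub tv _; apply: subsort_trans S23; apply: subsort_trans Sg2.
      exact: subsort_trans S1g.
    exact: tbs l_bs l_ts.
  (* The continuations have the smaller types [U] and [T3]; subsumption raises them to the types
     [T1] and [T2] reached by [Gamma]. *)
  exists l', (Gamma.[p <- T1].[q <- T2])%fmap, M'; split.
  + apply/guarded_sessionE; rewrite /= guarded_vsubst; split.
      by split=> //; apply: ball_lookup gQ' l_bs.
    by apply: sess_all_impl allN => ? ? _ [].
  + apply: (R_unfold _ (R_comm p q P1 N l_bs ev) (un_struct (sc_refl _))).
    apply: un_trans (un_struct scM) _; apply: un_trans unP _.
    (* Unfolding acts on the first component only, so [q] is moved ahead of [p] once [p] is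
       unfolded; this is also the order required by [R_comm]. *)
    have swap A B C : scong (SPar A (SPar B C)) (SPar B (SPar A C)).
      apply: sc_trans (sc_sym (sc_assoc _ _ _)) _.
      exact: sc_trans (sc_par (sc_comm _ _) (sc_refl _)) (sc_assoc _ _ _).
    apply: un_trans (un_struct (swap _ _ _)) _.
    exact: un_trans unQ (un_struct (sc_sym (sc_assoc _ _ _))).
  + apply: env_step_comm Gp Gq l_tp l_tq _.
    exact: subsort_trans Sg2.
  + split=> //.
      apply/sess_allP; split; first split.
      * by exists T2 => //; rewrite fnd_set eqxx.
      * exists T1; first by rewrite !fnd_set (negbTE pq) eqxx.
        exact: tp_sub UT1.
      * apply: sess_all_impl allN => r R rN [_ [T GT tR]]; exists T => //.
        (* Names are distinct, so no component of [N] is called [p] or [q] and the two updates leave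
           its entry alone. *)
        move: uniqM'; rewrite /participants /= inE negb_or -andbA.
        case/and4P=> _ qN pN _; rewrite !fnd_set.
        case: eqP => [rq | _]; first by rewrite -rq rN in qN.
        by case: eqP => [rp | _]; first by rewrite -rp rN in pN.
    exists G'; split=> //.
      exact: assoc_comm ascG prp' T1g prq' T2g prr in_red.
    by move=> r /in_red/ptG; rewrite (perm_mem permM').
- by have [? [? [_ _ sub]]] := typ_send_inv tQ'; inversion sub.
Qed.
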